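(* Let $F$ be a (non-empty) subset of a metric space. If for some $\theta \in (0,1)$ we have $\dim_{\mathrm{A}}^\theta F = \dim_\mathrm{A} F$, then \[ \dim_\mathrm{A}^{\theta'} F = \dim_\mathrm{A} F \] for all $\theta' \in [ \theta,1)$.
   Context: For a subset $E$ of a metric space and $r>0$, $N(E,r)$ denotes the minimal number of balls of radius $r$ required to cover $E$, and $B(x,R)$ is the ball of radius $R$ centred at $x$. The Assouad dimension of $F$ is \[ \dim_{\mathrm A} F = \inf\Big\{\alpha : \exists C>0,\ \exists \rho>0,\ \forall\, 0<r<R\leq\rho,\ \forall x\in F,\ N(B(x,R)\cap F,r)\leq C (R/r)^{\alpha}\Big\}. \] For $\theta\in(0,1)$, the Assouad spectrum of $F$ at $\theta$ is \[ \dim_{\mathrm A}^{\theta} F = \inf\Big\{\alpha : \exists C>0,\ \exists \rho>0,\ \forall\, 0<R\leq\rho,\ \forall x\in F,\ N(B(x,R)\cap F,R^{1/\theta})\leq C \big(R/R^{1/\theta}\big)^{\alpha}\Big\}. \] *)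

(* Defs.v *)
From HB Require Import structures.
From mathcomp Require Import all_boot all_order all_algebra.
From mathcomp Require Import all_classical all_reals all_analysis.

Set Implicit Arguments.
Unset Strict Implicit.
Unset Printing Implicit Defensive.

Import Order.TTheory GRing.Theory Num.Theory.

Local Open Scope classical_set_scope.
Local Open Scope ring_scope.

Section Dimensions.
Context {R : realType} {X : metricType R}.
Implicit Types (E F : set X) (r theta : R).

(* Balls are open, with centres anywhere in the ambient space.  The value is
   +oo when no finite family of balls of radius r covers E. *)
Definition covering_number E r : \bar R :=
  ereal_inf [set n%:R%:E | n in
    [set n : nat | exists c : 'I_n -> X,
      E `<=` \bigcup_(i in [set: 'I_n]) ball (c i) r]].

(* The infima are taken in the extended reals: a dimension is +oo when no
   exponent is admissible. *)
Definition assouad_dim F : \bar R :=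
  ereal_inf [set alpha%:E | alpha in
    [set alpha : R | exists C : R, 0 < C /\ exists rho : R, 0 < rho /\
      forall r S : R, 0 < r -> r < S -> S <= rho -> forall x, F x ->
        (covering_number (ball x S `&` F) r
           <= (C * (S / r) `^ alpha)%:E)%E]].

Definition assouad_spectrum theta F : \bar R :=
  ereal_inf [set alpha%:E | alpha in
    [set alpha : R | exists C : R, 0 < C /\ exists rho : R, 0 < rho /\
      forall S : R, 0 < S -> S <= rho -> forall x, F x ->
        (covering_number (ball x S `&` F) (S `^ (1 / theta))
           <= (C * (S / S `^ (1 / theta)) `^ alpha)%:E)%E]].

End Dimensions.

(* Main.v *)
Require Import Defs.
From mathcomp Require Import all_boot all_order all_algebra.
From mathcomp Require Import all_classical all_reals all_analysis.
From mathcomp Require Import lra ring.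

Import Order.TTheory GRing.Theory Num.Theory.

Local Open Scope classical_set_scope.
Local Open Scope ring_scope.

(** Write a = 1 / theta and b = 1 / theta', so that 1 < b <= a, and
    N(S, r) for the largest number of balls of radius r needed to cover
    a set B(x, S) `&` F with x in F.

    The inequality dim^theta' F <= dim F is immediate (spectrum_le_dim): the
    spectrum tests only some of the pairs of scales that the Assouad dimension
    tests.  Suppose that it is strict, so that some exponent s < dim F is
    admissible for theta'.  A cover can be refined: cover B(x, S) `&` F by
    balls of radius S^b, and then each of these by balls of radius S^a
    (covering_number_comp).

    If A = dim F is finite, the second stage has an exponent alpha close to A,
    and (power_bound_refine)
      N(S, S^a) <= C (S / S^b)^s (S^b / S^a)^alpha.
    This is an admissible exponent ((b - 1) s + (a - b) alpha) / (a - 1) for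
    theta.  It is a weighted mean of s < A and of alpha, hence smaller than A
    once alpha is close enough to A.  So dim^theta F < A, against the
    hypothesis.

    If dim F is infinite, no alpha is available, but the estimate at theta'
    can be applied to itself: S is refined to S^b, then to a power close to
    b^2, b^3, and so on, until the exponent exceeds a (power_bound_finer).
    The number of balls remains a power of S, so dim^theta F is finite, again
    against the hypothesis.

    Constants and ranges of scales are absorbed by working with bounds of the
    form C S^(-p), valid for all small enough S (power_bound). *)

(** * Covering numbers *)

(** The covering number is an infimum of natural numbers, so it is attained
    when it is finite.  Lists of centres are used rather than families indexed
    by ordinals because covers are concatenated below. *)
Lemma covering_number_leP (R : realType) (X : metricType R) (E : set X)
    (r v : R) :
  (covering_number E r <= v%:E)%E <->
  exists2 s : seq X, (size s)%:R <= v &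
    E `<=` [set z | exists2 c, c \in s & ball c r z].
Proof.
split; last first.
  move=> [s sv Es]; apply: (@le_trans _ _ ((size s)%:R%:E)); last first.
    by rewrite lee_fin.
  apply: ereal_inf_lbound; exists (size s) => //=.
  exists (tnth (in_tuple s)) => z /Es[c cs cz].
  by have /tnthP[i ci] : c \in in_tuple s := cs; exists i => //; rewrite -ci.
move=> Ev.
(* The set of sizes of covers is nonempty; its least element is the infimum. *)
pose P n := `[< exists c : 'I_n -> X,
  E `<=` \bigcup_(i in [set: 'I_n]) ball (c i) r >].
have exP : exists n, P n.
  have : (covering_number E r < (v + 1)%:E)%E.
    by rewrite (le_lt_trans Ev)// lte_fin ltrDl.
  by move=> /ereal_inf_ltP[_ [n Pn _] _]; exists n; apply/asboolP.
case: (ex_minnP exP) => n /asboolP[c Ec] nmin.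
exists [seq c i | i <- enum 'I_n].
  rewrite size_map size_enum_ord -lee_fin (le_trans _ Ev)//.
  apply: le_ereal_inf_tmp => _ [m Pm <-].
  by rewrite lee_fin ler_nat; apply: nmin; apply/asboolP.
move=> z /Ec[i _ ciz]; exists (c i) => //.
by apply: map_f; rewrite mem_enum.
Qed.

(** Refining a cover at scale t to a cover at scale r.  The centres of the
    first cover may lie outside F, whereas covering bounds are known only
    around points of F: a ball of radius t that meets F at y is replaced by
    the ball of radius 2 * t around y. *)
Lemma covering_number_comp (R : realType) (X : metricType R) (E F : set X)
    (t r N M : R) :
  E `<=` F -> 0 <= M -> (covering_number E t <= N%:E)%E ->
  (forall y, F y -> (covering_number (ball y (2 * t) `&` F) r <= M%:E)%E) ->
  (covering_number E r <= (N * M)%:E)%E.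
Proof.
move=> EF M0 /covering_number_leP[s sN Es] FM; apply/covering_number_leP.
have [s' s'M Fs'] : exists2 s' : seq X, (size s')%:R <= (size s)%:R * M &
    [set z | exists2 c, c \in s & ball c t z] `&` F `<=`
    [set z | exists2 c, c \in s' & ball c r z].
  elim: {sN Es} s => [|c s [s' s'M Fs']].
    by exists [::]; [rewrite mul0r|move=> z [[]]].
  (* A ball that misses F is dropped. *)
  have [s1 s1M Fs1] : exists2 s1 : seq X, (size s1)%:R <= M &
      ball c t `&` F `<=` [set z | exists2 c, c \in s1 & ball c r z].
    have [[y [cy Fy]]|/forallNP cF] := pselect (ball c t `&` F !=set0).
      have [s1 s1M Fs1] := (covering_number_leP _ _ _ _ _).1 (FM y Fy).
      exists s1 => // z [cz Fz]; apply: Fs1; split => //.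
      rewrite mulr_natl mulr2n; apply: ball_triangle cz.
      exact: ball_sym.
    by exists [::] => // z /cF.
  exists (s1 ++ s').
    by rewrite size_cat natrD /= -natr1 mulrDl mul1r addrC lerD.
  move=> z [[d]]; rewrite inE => /predU1P[->|ds] dz Fz.
    by have [|e es ez] := Fs1 z; [split|exists e; rewrite // mem_cat es].
  have [|e es ez] := Fs' z; first by split => //; exists d.
  by exists e => //; rewrite mem_cat es orbT.
exists s'; first by rewrite (le_trans s'M)// ler_wpM2r.
by move=> z Ez; apply: Fs'; split; [exact: Es|exact: EF].
Qed.

Lemma le_covering_number (R : realType) (X : metricType R) (E E' : set X)
    (r r' : R) : E `<=` E' -> r' <= r ->
  (covering_number E r <= covering_number E' r')%E.
Proof.
move=> EE' rr'; apply: le_ereal_inf => _ [n [c E'c] <-]; exists n => //.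
exists c => z /EE'/E'c[i _ cz]; exists i => //.
exact: le_ball cz.
Qed.

(** * Power bounds at small scales *)

Section power_bound.
Context {R : realType}.

(** Translates between the threshold rho of the dimensions and filters, under
    which several smallness conditions on S combine without bookkeeping. *)
Lemma near_at_right0P (P : R -> Prop) :
  (\forall S \near 0^'+, P S) <->
  exists rho, 0 < rho /\ forall S, 0 < S -> S <= rho -> P S.
Proof.
split=> [[e /= e0 eP]|[rho [rho0 rhoP]]].
  exists (e / 2); split; first by rewrite divr_gt0.
  move=> S S0 Se; apply: eP => //=.
  rewrite sub0r normrN gtr0_norm// (le_lt_trans Se)//; lra.
near=> S; apply: rhoP; near: S.
  exact: nbhs_right_gt.
exact: nbhs_right_le.
Unshelve. all: by end_near. Qed.

Lemma gt0_powRD (x r s : R) : 0 < x -> x `^ (r + s) = x `^ r * x `^ s.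
Proof. by move=> x0; rewrite powRD// lt0r_neq0// implybT. Qed.

Lemma gt0_powRB (x r s : R) : 0 < x -> x `^ (r - s) = x `^ r / x `^ s.
Proof. by move=> x0; rewrite gt0_powRD// powRN. Qed.

Lemma near_powR_le (e c : R) : 0 < e -> 0 < c ->
  \forall S \near 0^'+, S `^ e <= c.
Proof.
move=> e0 c0; apply/near_at_right0P; exists (c `^ e^-1).
split; first exact: powR_gt0.
move=> S S0 Sc; rewrite -(powRr1 (ltW c0)) -(mulVf (lt0r_neq0 e0)) powRrM.
by apply: ge0_ler_powR => //; rewrite ?nnegrE ?powR_ge0// ltW.
Qed.

Context {X : metricType R}.
Implicit Types (F : set X) (a b c p q : R).

(** The exponent is normalised as a power of S, not of the ratio S / S `^ a, so
    that the exponents of successive refinements add up. *)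
Definition power_bound F a p := exists C : R, 0 < C /\
  \forall S \near 0^'+, forall x, F x ->
    (covering_number (ball x S `&` F) (S `^ a) <= (C * S `^ (- p))%:E)%E.

(** Since S / S^(1 / theta) = S^(- (1 / theta - 1)), the exponents admissible
    for the spectrum are power bounds up to the factor 1 / theta - 1. *)
Lemma spectrum_ltP F (theta : R) (v : \bar R) :
  (assouad_spectrum theta F < v)%E <->
  exists2 s : R, (s%:E < v)%E & power_bound F (1 / theta) ((1 / theta - 1) * s).
Proof.
have ratioE (S s : R) : 0 < S ->
    (S / S `^ (1 / theta)) `^ s = S `^ (- ((1 / theta - 1) * s)).
  move=> S0; rewrite -{1}(powRr1 (ltW S0)) -gt0_powRB//.
  by rewrite -powRrM; congr (_ `^ _); ring.
split.
  move=> /ereal_inf_ltP[_ [s [C [C0 Cs]] <-] sv]; exists s => //.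
  exists C; split => //; apply/near_at_right0P.
  have [rho [rho0 H]] := Cs; exists rho; split => // S S0 Sr x Fx.
  by rewrite -ratioE//; exact: H.
move=> [s sv [C [C0 /near_at_right0P[rho [rho0 H]]]]].
apply/ereal_inf_ltP; exists s%:E => //; exists s => //.
exists C; split => //; exists rho; split => // S S0 Sr x Fx.
by rewrite ratioE//; exact: H.
Qed.

Lemma power_bound_le F a b p : a <= b -> power_bound F b p -> power_bound F a p.
Proof.
move=> ab [C [C0 H]]; exists C; split => //; near=> S => x Fx.
have S0 : 0 < S by near: S; exact: nbhs_right_gt.
have S1 : S <= 1 by near: S; exact: nbhs_right_le.
apply: (@le_trans _ _ (covering_number (ball x S `&` F) (S `^ b))); last first.
  by move: x Fx; near: S; exact: H.
by apply: le_covering_number => //; apply: ger_powR => //; rewrite S0 S1.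
Unshelve. all: by end_near. Qed.

(** Applying the second bound to balls of radius S^b' instead of S^b absorbs
    the doubling of the radius in covering_number_comp: as b' < b, one has
    2 * S^b <= S^b' for small S.  No constant then disturbs the final scale
    (S^b')^c. *)
Lemma power_bound_comp F b b' c p q : 1 <= b' -> b' < b ->
  power_bound F b p -> power_bound F c q ->
  power_bound F (b' * c) (p + b' * q).
Proof.
move=> b'1 b'b [C [C0 H]] [D [D0 /near_at_right0P[rho [rho0 HD]]]].
exists (C * D); split; first exact: mulr_gt0.
near=> S => x Fx.
have S0 : 0 < S by near: S; exact: nbhs_right_gt.
have S1 : S <= 1 by near: S; exact: nbhs_right_le.
have Srho : S <= rho by near: S; exact: nbhs_right_le.
have Sb' : S `^ (b - b') <= 2^-1.
  by near: S; apply: near_powR_le; rewrite ?subr_gt0.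
have -> : C * D * S `^ (- (p + b' * q)) =
    C * S `^ (- p) * (D * (S `^ b') `^ (- q)).
  rewrite opprD gt0_powRD// -mulrN powRrM.
  by ring.
apply: (covering_number_comp _ _ _ F (S `^ b)).
- exact: subIsetr.
- by rewrite mulr_ge0 ?powR_ge0// ltW.
- by move: x Fx; near: S; exact: H.
move=> y Fy; rewrite powRrM.
have := HD (S `^ b') (powR_gt0 _ S0).
have SS : S `^ b' <= rho.
  by rewrite (le_trans _ Srho)// ge1r_powR// S0 S1.
move=> /(_ SS y Fy); apply: le_trans.
apply: le_covering_number => //; apply: setSI; apply: le_ball.
rewrite -[b](subrK b') gt0_powRD//.
rewrite mulrA ler_piMl ?powR_ge0//.
by rewrite -ler_pdivlMl// mulr1.
Unshelve. all: by end_near. Qed.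

(** Iterating the previous lemma with a fixed b' strictly between 1 and b gives
    power bounds at the scales S^(b'^n), and b'^n eventually exceeds a. *)
Lemma power_bound_finer F a b p : 1 < b -> power_bound F b p ->
  exists q, power_bound F a q.
Proof.
move=> b1 Hb; pose b' := (1 + b) / 2.
have b'1 : 1 < b' by rewrite /b'; lra.
have b'b : b' < b by rewrite /b'; lra.
have iter n : exists q, power_bound F (b' ^+ n.+1) q.
  elim: n => [|n [q Hq]].
    by exists p; rewrite expr1; apply: power_bound_le Hb; exact: ltW.
  by exists (p + b' * q); rewrite exprS; apply: power_bound_comp Hb Hq => //;
    exact: ltW.
have [n an] : exists n, a <= b' ^+ n.+1.
  have bernoulli n : n%:R * (b' - 1) <= b' ^+ n.
    elim: n => [|n IHn]; first by rewrite mul0r.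
    have : 1 <= b' ^+ n by rewrite exprn_ege1// ltW.
    by rewrite exprS -natr1; nra.
  exists (Num.bound `|a / (b' - 1)|); apply: le_trans (bernoulli _).
  rewrite -ler_pdivrMr ?subr_gt0//.
  rewrite (le_trans (ler_norm _))// ltW// (lt_trans (archi_boundP _)) ?ltr_nat//.
by have [q Hq] := iter n; exists q; exact: power_bound_le Hq.
Qed.

End power_bound.

(** * Comparing the spectrum with the Assouad dimension *)

Definition assouad_exponent (R : realType) (X : metricType R) (F : set X)
    (alpha : R) := exists C : R, 0 < C /\ exists rho : R, 0 < rho /\
  forall r S : R, 0 < r -> r < S -> S <= rho -> forall x, F x ->
    (covering_number (ball x S `&` F) r <= (C * (S / r) `^ alpha)%:E)%E.

(** Here the Assouad bound is applied between the scales 2 * S^b and S^a; as it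
    holds for all pairs of scales, the factor 2 only changes the constant, by
    2^alpha, and b is not replaced by a smaller exponent. *)
Lemma power_bound_refine (R : realType) (X : metricType R) (F : set X)
    (a b p alpha : R) : 1 <= b -> b <= a ->
  power_bound F b p -> assouad_exponent R X F alpha ->
  power_bound F a (p + (a - b) * alpha).
Proof.
move=> b1 ba [C [C0 H]] [D [D0 [rho [rho0 HD]]]].
exists (C * (D * 2 `^ alpha)); split; first by rewrite !mulr_gt0// powR_gt0.
near=> S => x Fx.
have S0 : 0 < S by near: S; exact: nbhs_right_gt.
have S1 : S <= 1 by near: S; exact: nbhs_right_le.
have Srho : S <= rho / 2 by near: S; apply: nbhs_right_le; rewrite divr_gt0.
have Sb : S `^ b <= S by rewrite ge1r_powR// S0 S1.
have Sa : S `^ a <= S `^ b by apply: ger_powR => //; rewrite S0 S1.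
have Sb0 : 0 < S `^ b := powR_gt0 _ S0.
have -> : C * (D * 2 `^ alpha) * S `^ (- (p + (a - b) * alpha)) =
    C * S `^ (- p) * (D * (2 * S `^ b / S `^ a) `^ alpha).
  rewrite -[2 * _ / _]mulrA -gt0_powRB// powRM ?powR_ge0// -powRrM.
  rewrite opprD gt0_powRD// -[- (_ * alpha)]mulNr opprB.
  by ring.
apply: (covering_number_comp _ _ _ F (S `^ b)).
- exact: subIsetr.
- by rewrite mulr_ge0 ?powR_ge0// ltW.
- by move: x Fx; near: S; exact: H.
move=> y Fy; apply: HD => //; first exact: powR_gt0.
- lra.
- lra.
Unshelve. all: by end_near. Qed.

Lemma assouad_dim_ltP (R : realType) (X : metricType R) (F : set X)
    (v : \bar R) : (assouad_dim F < v)%E <->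
  exists2 alpha : R, (alpha%:E < v)%E & assouad_exponent R X F alpha.
Proof.
split=> [/ereal_inf_ltP[_ [s Fs <-] sv]|[s sv Fs]]; first by exists s.
by apply/ereal_inf_ltP; exists s%:E => //; exists s.
Qed.

Lemma spectrum_le_dim (R : realType) (X : metricType R) (F : set X)
    (theta : R) : 0 < theta -> theta < 1 ->
  (assouad_spectrum theta F <= assouad_dim F)%E.
Proof.
move=> t0 t1; apply: le_ereal_inf => _ [s [C [C0 [rho [rho0 H]]]] <-].
exists s => //; exists C; split => //.
exists (Num.min rho (1 / 2)); split; first by rewrite lt_min rho0/=; lra.
move=> S S0; rewrite le_min => /andP[Sr S1] x Fx; apply: H => //.
  exact: powR_gt0.
(* S^(1 / theta) < S because S < 1 < 1 / theta. *)
rewrite -{2}(powRr1 (ltW S0)) /powR gt_eqF// ltr_expR ltr_nM2r.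
  by rewrite ltr_pdivlMr// mul1r.
by rewrite ln_lt0// S0/=; lra.
Qed.

Theorem corollary3p6 (R : realType) (X : metricType R) (F : set X)
    (F_neq0 : F !=set0) (theta : R) (theta_gt0 : 0 < theta)
    (theta_lt1 : theta < 1)
    (dimE : assouad_spectrum theta F = assouad_dim F) :
  forall theta' : R, theta <= theta' -> theta' < 1 ->
    assouad_spectrum theta' F = assouad_dim F.
Proof.
move=> theta' le_theta theta'_lt1.
have theta'_gt0 : 0 < theta' := lt_le_trans theta_gt0 le_theta.
apply/eqP; rewrite eq_le spectrum_le_dim//= leNgt; apply/negP.
move=> /spectrum_ltP[s s_lt].
set b := 1 / theta'; pose a := 1 / theta => Fb.
have b1 : 1 < b by rewrite /b ltr_pdivlMr// mul1r.
have ba : b <= a by rewrite /b /a !div1r lef_pV2.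
(* s is an exponent too small for theta'; it yields one too small for theta. *)
suff : (assouad_spectrum theta F < assouad_dim F)%E by rewrite dimE ltxx.
apply/spectrum_ltP; rewrite -/a.
case dimF: (assouad_dim F) s_lt => [A| |] // s_lt.
  rewrite lte_fin in s_lt.
  (* With alpha = A + e the new exponent is at most A exactly when
     (a - b) * e <= (b - 1) * (A - s); this e satisfies it, as a - b < a - 1. *)
  pose e := (b - 1) * (A - s) / (a - 1).
  have e0 : 0 < e by rewrite /e divr_gt0// ?mulr_gt0; lra.
  have : (assouad_dim F < (A + e)%:E)%E by rewrite dimF lte_fin; lra.
  move=> /assouad_dim_ltP[alpha]; rewrite lte_fin => alphaA Falpha.
  exists (((b - 1) * s + (a - b) * alpha) / (a - 1)).
    rewrite lte_fin ltr_pdivrMr; last lra.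
    have eE : e * (a - 1) = (b - 1) * (A - s) by rewrite /e divfK//; lra.
    nra.
  rewrite mulrC divfK; last lra.
  by apply: power_bound_refine => //; exact: ltW.
(* Infinite dimension: any finite exponent for theta is a contradiction. *)
have [q Hq] := power_bound_finer F a _ _ b1 Fb.
exists (q / (a - 1)); first exact: ltry.
by rewrite mulrC divfK//; lra.
Qed.
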